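(* Let $r,n$ be positive integers, let $A\in RI(r,n)$, let $m$ be a positive integer with $m\le n$, and set $t=\frac mn$, $\alpha=\frac tr$. Then $$\mathrm{per}_m(A)\ \ge\ SF(r,n,m):=\frac{(1-\alpha)^{(1-\alpha)nr}\,(1-n^{-1})^{(1-n^{-1})2n^2(1-t)}}{\alpha^{nt}\, n^{-2n(1-t)}\,\big((n(1-t))!\big)^2}.$$
   Context: $RI(r,n)$ is the set of $n\times n$ matrices with non-negative integer entries all of whose row and column sums equal $r$. For an $n\times n$ matrix $A$ and $1\le m\le n$, $\mathrm{per}_m(A)=\sum_{|S|=|T|=m}\mathrm{per}(A_{S,T})$, the sum of the permanents of all $m\times m$ submatrices $A_{S,T}$ (rows $S$, columns $T$). Convention $0^0=1$. *)

(* Defs.v *)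
From HB Require Import structures.
From mathcomp Require Import all_boot all_order all_algebra all_fingroup.
From mathcomp Require Import reals exp.
Set Implicit Arguments. Unset Strict Implicit. Unset Printing Implicit Defensive.
Import Order.TTheory GRing.Theory Num.Theory.

Definition RI (r n : nat) (A : 'M[nat]_n) : Prop :=
  (forall i : 'I_n, \sum_(j < n) A i j = r) /\
  (forall j : 'I_n, \sum_(i < n) A i j = r).

Arguments RI r n A : clear implicits.

Definition per (k : nat) (B : 'M[nat]_k) : nat :=
  \sum_(s : 'S_k) \prod_(i < k) B i (s i).

(* the m x m submatrix A_{S,T}, rows S, columns T (in increasing order) *)
Definition subST (n m : nat) (A : 'M[nat]_n)
    (S T : {S : {set 'I_n} | #|S| == m}) : 'M[nat]_m :=
  \matrix_(i < m, j < m)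
    A (enum_val (cast_ord (esym (eqP (valP S))) i))
      (enum_val (cast_ord (esym (eqP (valP T))) j)).

Definition per_m (n : nat) (A : 'M[nat]_n) (m : nat) : nat :=
  \sum_(S : {S : {set 'I_n} | #|S| == m})
    \sum_(T : {T : {set 'I_n} | #|T| == m}) per (subST A S T).

Local Open Scope ring_scope.

(* SF(r,n,m), with real exponents; powR satisfies 0 `^ 0 = 1 *)
Definition SF (R : realType) (r n m : nat) : R :=
  let t : R := m%:R / n%:R in
  let alpha : R := t / r%:R in
  ((1 - alpha) `^ ((1 - alpha) * n%:R * r%:R)
    * (1 - n%:R^-1) `^ ((1 - n%:R^-1) * 2 * n%:R ^+ 2 * (1 - t)))
  / (alpha `^ (n%:R * t) * n%:R `^ (- (2 * n%:R * (1 - t)))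
     * ((n - m)`!)%:R ^+ 2).

(* Main.v *)
Require Import Defs.
From HB Require Import structures.
From mathcomp Require Import all_boot all_order all_algebra all_fingroup.
From mathcomp Require Import reals exp.
From mathcomp Require Import zify ring lra.
Set Implicit Arguments. Unset Strict Implicit. Unset Printing Implicit Defensive.
Import Order.TTheory GRing.Theory Num.Theory.
Local Open Scope ring_scope.

(** With [k = n - m], [per_m A * k!^2] counts the perfect matchings of the
    bipartite multigraph obtained from [A] by adding [k] rows and [k] columns,
    each new vertex being joined to all old vertices of the other side.  Weighting
    the edges of [A] by [t / r] and the new edges by [1 / n] is doubly stochastic,
    so the bound is the Bethe lower bound on the number of perfect matchings,
    [prod_e al_e^-al_e (1 - al_e)^(1 - al_e)].

    The Bethe bound is proved for the monomer-dimer partition function with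
    arbitrary nonnegative vertex weights, by adding edges one at a time.  As a
    function of the weights of two vertices [p] and [q] of different sides, the
    partition function is [a + b y + c z + d y z] with [b c <= a d]
    (Heilmann-Lieb), and after the addition of the edge [pq] it is [a + d];
    this is bounded below by choosing [y] and [z] suitably in the bound known
    for the smaller graph, and weighted AM-GM updates the vertex factors. *)

(** * Monomer-dimer partition functions: expansion at a vertex and affine dependence on weights *)

(* Monomer-dimer partition function, with monomer weights [x], of the multigraph
   with edge list [s] induced on [A]; the recursion is on the edge list. *)
Fixpoint md (R : numDomainType) (V : finType) (x : V -> R) (s : seq (V * V))
    (A : {set V}) : R :=
  if s is e :: s' then
    md x s' A
    + md x s' (A :\ e.1 :\ e.2) *+ [&& e.1 \in A, e.2 \in A & e.1 != e.2]
  else \prod_(v in A) x v.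

Definition mult (V : finType) (s : seq (V * V)) (u v : V) : nat :=
  count_mem (u, v) s + count_mem (v, u) s.

Section MonomerDimer.
Variables (R : numDomainType) (V : finType).
Implicit Types (x : V -> R) (s : seq (V * V)) (A : {set V}) (u v : V).

Lemma md_ge0 x s A : (forall v, 0 <= x v) -> 0 <= md x s A.
Proof.
move=> x0; elim: s A => [|e s IH] A /=; first exact: prodr_ge0.
by rewrite addr_ge0 // mulrn_wge0.
Qed.

(** Either [u] is a monomer or it is matched along one of the [mult s u v] edges to some [v]. As
    [md] recurses on edges and not on vertices, the induction splits on whether the first edge
    touches [u]. *)
Lemma md_expand x s A u : u \in A ->
  md x s A = x u * md x s (A :\ u)
             + \sum_(v in A :\ u) md x s (A :\ u :\ v) *+ mult s u v.
Proof.
elim: s A => [|[p q] s IH] A uA.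
  by rewrite /= (big_setD1 u) //= [X in _ + X]big1 ?addr0 // => v _; rewrite mulr0n.
have multE v : mult ((p, q) :: s) u v =
    (((p, q) == (u, v)) + ((p, q) == (v, u)) + mult s u v)%N.
  by rewrite /mult /=; lia.
rewrite (eq_bigr (fun v => md x ((p, q) :: s) (A :\ u :\ v) *+ ((p, q) == (u, v))
   + md x ((p, q) :: s) (A :\ u :\ v) *+ ((p, q) == (v, u))
   + md x ((p, q) :: s) (A :\ u :\ v) *+ mult s u v)); last first.
  by move=> v _; rewrite multE !mulrnDr.
rewrite !big_split.
have sel w (F : V -> R) : \sum_(v in A :\ u) F v *+ (w == v) = F w *+ (w \in A :\ u).
  rewrite (bigID (pred1 w)) /= [X in _ + X]big1 ?addr0; last first.
    by move=> v /andP[_]; rewrite eq_sym => /negPf ->; rewrite mulr0n.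
  case: (boolP (w \in A :\ u)) => wA.
    rewrite (big_pred1 w) ?eqxx // => v /=.
    by case: eqP => [->|]; rewrite ?andbF ?andbT.
  by rewrite big_pred0 // => v; apply/andP => -[vA /eqP vw]; rewrite -vw vA in wA.
(* An edge at [u] is invisible once [u] is deleted, so the head edge only supplies the extra term at
   its other endpoint. *)
have [pu|pu] := eqVneq p u.
  have mdE (B : {set V}) : u \notin B -> md x ((p, q) :: s) B = md x s B.
    by move=> uB; rewrite /= pu (negPf uB) mulr0n addr0.
  rewrite [X in x u * X]mdE ?inE ?eqxx //.
  under [X in _ + (X + _ + _)]eq_bigr do rewrite mdE ?inE ?eqxx ?andbF //.
  under [X in _ + (_ + X + _)]eq_bigr do rewrite mdE ?inE ?eqxx ?andbF //.
  under [X in _ + (_ + X)]eq_bigr do rewrite mdE ?inE ?eqxx ?andbF //.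
  rewrite [X in _ + (_ + X + _)]big1 ?addr0; last first.
    by move=> v; rewrite !inE => /andP[/negPf vu _]; rewrite xpair_eqE pu eq_sym vu mulr0n.
  rewrite [X in _ + (X + _)](eq_bigr (fun v => md x s (A :\ u :\ v) *+ (q == v))); last first.
    by move=> v _; rewrite xpair_eqE pu eqxx.
  rewrite sel [LHS]/= pu uA (IH A uA) !inE (eq_sym u q) (andbC (q != u)) ?andbT /=.
  by rewrite -addrA; congr (_ + _); rewrite addrC.
have [qu|qu] := eqVneq q u.
  have mdE (B : {set V}) : u \notin B -> md x ((p, q) :: s) B = md x s B.
    by move=> uB; rewrite /= qu (negPf uB) andbF mulr0n addr0.
  rewrite [X in x u * X]mdE ?inE ?eqxx //.
  under [X in _ + (X + _ + _)]eq_bigr do rewrite mdE ?inE ?eqxx ?andbF //.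
  under [X in _ + (_ + X + _)]eq_bigr do rewrite mdE ?inE ?eqxx ?andbF //.
  under [X in _ + (_ + X)]eq_bigr do rewrite mdE ?inE ?eqxx ?andbF //.
  rewrite [X in _ + (X + _ + _)]big1 ?add0r; last first.
    by move=> v _; rewrite xpair_eqE (negPf pu) mulr0n.
  rewrite [X in _ + (X + _)](eq_bigr (fun v => md x s (A :\ u :\ v) *+ (p == v))); last first.
    by move=> v _; rewrite xpair_eqE qu eqxx andbT.
  rewrite sel [LHS]/= qu uA (IH A uA) !inE (andbC (p != u)) pu ?andbT /=.
  rewrite -addrA; congr (_ + _); rewrite addrC; congr (_ + _).
  by rewrite !setDDl setUC.
(* The head edge avoids [u]: the summands with and without it are both expanded at [u], and vertex
   deletions commute. *)
rewrite [X in _ + (X + _ + _)]big1 ?add0r; last first.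
  by move=> v _; rewrite xpair_eqE (negPf pu) mulr0n.
rewrite [X in _ + (X + _)]big1 ?add0r; last first.
  by move=> v _; rewrite xpair_eqE (negPf qu) andbF mulr0n.
rewrite /=.
under eq_bigr do rewrite mulrnDl.
rewrite big_split /= (IH A uA) mulrDr -!addrA; congr (_ + _).
rewrite addrCA; congr (_ + _).
have -> : [&& p \in A :\ u, q \in A :\ u & p != q] = [&& p \in A, q \in A & p != q].
  by rewrite !inE pu qu.
case: (boolP [&& p \in A, q \in A & p != q]) => /= cond; last first.
  rewrite !mulr0n mulr0 add0r big1 // => v _.
  suff /negPf-> : ~~ [&& p \in A :\ u :\ v, q \in A :\ u :\ v & p != q] by rewrite mulr0n mul0rn.
  apply: contra cond => /and3P[]; rewrite !inE.
  by move=> /and3P[_ _ ->] /and3P[_ _ ->] ->.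
case/and3P: cond => pA qA pq.
rewrite !mulr1n IH; last by rewrite !inE uA !(eq_sym u) pu qu.
have cm B a b : B :\ a :\ b = B :\ b :\ a :> {set V} by rewrite !setDDl setUC.
congr (_ + _); first by rewrite [A :\ p :\ q :\ u]cm [A :\ p :\ u]cm.
rewrite [RHS](bigID (fun v => (v != p) && (v != q))) /= [X in _ = _ + X]big1 ?addr0; last first.
  move=> v /andP[_]; rewrite negb_and !negbK !inE => /orP[]/eqP->; rewrite eqxx ?andbF mulr0n mul0rn //.
apply: eq_big => [v|v].
  by rewrite !inE; case: (v == u); case: (v == p); case: (v == q); rewrite ?andbF ?andbT.
rewrite !inE => /and4P[vu vq vp vA]; rewrite !(eq_sym _ v) vp vq pu qu pA qA pq mulr1n.
congr (md x s _ *+ _).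
by apply/setP=> w; rewrite !inE; case: (w == u); case: (w == p); case: (w == q); case: (w == v).
Qed.

Lemma eq_md x y s A : {in A, x =1 y} -> md x s A = md y s A.
Proof.
elim: s A => [|e s IH] A xy /=; first exact: eq_bigr.
by rewrite !IH // => v; rewrite !inE => /and3P[_ _] /xy.
Qed.

(** By the expansion at [u], the weight of [u] enters only through the monomer term, with
    coefficient [md x s (A :\ u)]. *)
Lemma md_shift x s A u t : u \in A ->
  md (fun v => x v + t *+ (v == u)) s A = md x s A + t * md x s (A :\ u).
Proof.
move=> uA; rewrite !(@md_expand _ s A u uA) eqxx mulr1n mulrDl addrAC.
rewrite (@eq_md _ x); last first.
  by move=> v; rewrite !inE => /andP[/negPf-> _]; rewrite mulr0n addr0.
congr (_ + _ + _); apply: eq_bigr => v _; rewrite (@eq_md _ x) // => w.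
by rewrite !inE => /and3P[_ /negPf-> _]; rewrite mulr0n addr0.
Qed.

Lemma mult_sym s u v : mult s u v = mult s v u.
Proof. by rewrite /mult addnC. Qed.

End MonomerDimer.

(** * Heilmann-Lieb correlation inequality for bipartite multigraphs *)

Section HeilmannLieb.
Variables (R : realDomainType) (V : finType) (c : V -> bool).
Variables (x : V -> R) (s : seq (V * V)).
Hypothesis c_edge : all (fun e => c e.1 != c e.2) s.

Lemma mult_monochromatic u v : c u = c v -> mult s u v = 0%N.
Proof.
move=> cuv; apply/eqP; rewrite addn_eq0; apply/andP.
by split; apply/eqP/count_memPn; apply/negP=> /(allP c_edge) /=; rewrite cuv eqxx.
Qed.

(* Expanding the four partition functions at [u] turns the inequality for two
   vertices of the same colour into the one for opposite colours on a smaller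
   vertex set, and conversely up to the square [md x s (A :\ u :\ v) ^+ 2]. *)
Lemma heilmann_lieb (A : {set V}) u v : u \in A -> v \in A -> u != v ->
  let d := md x s A * md x s (A :\ u :\ v)
           - md x s (A :\ u) * md x s (A :\ v) in
  if c u == c v then d <= 0 else 0 <= d.
Proof.
have [k] := ubnP #|A|; elim: k A u v => // k IH A u v; rewrite ltnS => Ak uA vA uv.
have uAv : u \in A :\ v by rewrite !inE uv.
have cm B a b : B :\ a :\ b = B :\ b :\ a :> {set V} by rewrite !setDDl setUC.
pose Z := md x s; rewrite /= -!/(Z _).
have vAu : v \in A :\ u by rewrite !inE eq_sym uv.
have Au : (#|A :\ u| < k)%N by move: Ak; rewrite (cardsD1 u) uA.
(* [Z A] and [Z (A :\ v)] are expanded at [u]; the term of [Z A] matching [u] with [v] has no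
   counterpart and leaves the square. *)
have -> : Z A * Z (A :\ u :\ v) - Z (A :\ u) * Z (A :\ v) =
  Z (A :\ u :\ v) ^+ 2 *+ mult s u v +
  \sum_(j in A :\ u :\ v)
   (Z (A :\ u :\ j) * Z (A :\ u :\ v) - Z (A :\ u) * Z (A :\ u :\ j :\ v)) *+ mult s u j.
  rewrite {1}/Z (md_expand _ _ uA) [Z (A :\ v)](md_expand _ _ uAv) -!/(Z _).
  rewrite (big_setD1 v vAu) /= -[A :\ v :\ u]cm.
  set S1 := \sum_(j in _) _; set S2 := \sum_(j in _) _; set S3 := \sum_(j in _) _.
  have -> : S3 = S1 * Z (A :\ u :\ v) - Z (A :\ u) * S2.
    rewrite mulr_suml mulr_sumr -sumrB; apply: eq_bigr => j _.
    by rewrite mulrnBl mulrnAl mulrnAr [A :\ u :\ j :\ v]cm.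
  rewrite -[_ *+ _]mulr_natr -[X in _ = X + _]mulr_natr; rewrite -!/(Z _); ring.
case: ifP => cuv.
  rewrite mult_monochromatic ?(eqP cuv) // mulr0n add0r sumr_le0 // => j.
  rewrite !inE => /and3P[jv ju jA].
  have [cuj|cuj] := eqVneq (c u) (c j); first by rewrite mult_monochromatic.
  apply: mulrn_wle0; rewrite subr_le0.
  have := IH (A :\ u) j v Au _ vAu jv; rewrite !inE ju jA => /(_ isT) /=.
  by rewrite -(eqP cuv) eq_sym (negPf cuj) subr_ge0 -!/(Z _).
rewrite addr_ge0 ?mulrn_wge0 ?sqr_ge0 // sumr_ge0 // => j.
rewrite !inE => /and3P[jv ju jA].
have [cuj|cuj] := eqVneq (c u) (c j); first by rewrite mult_monochromatic.
apply: mulrn_wge0; rewrite subr_ge0.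
have := IH (A :\ u) j v Au _ vAu jv; rewrite !inE ju jA => /(_ isT) /=.
have -> : c j == c v by case: (c j) (c v) (c u) cuj cuv => [] [] [].
by rewrite subr_le0 -!/(Z _).
Qed.

End HeilmannLieb.

(** * Weighted AM-GM and the contraction inequality *)

Section RealInequalities.
Variable R : realType.
Implicit Types a b c d x y p q al B : R.

Lemma ler_lnB x y : 0 < x -> 0 < y -> ln x - ln y <= x / y - 1.
Proof.
move=> x0 y0; rewrite -ln_div ?posrE //.
have -> : x / y = 1 + (x / y - 1) by ring.
apply: le_trans (le_ln1Dx _) _; last by lra.
by have : 0 < x / y by [rewrite divr_gt0]; lra.
Qed.

(** For positive data, the tangent bound for [ln] at the weighted mean is summed with weights [p]
    and [q], and the linear terms cancel. Zero exponents rely on the power being 1 there. *)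
Lemma powR_amgm x y p q : 0 <= x -> 0 <= y -> 0 <= p -> 0 <= q ->
  (x / p) `^ p * (y / q) `^ q <= ((x + y) / (p + q)) `^ (p + q).
Proof.
move=> x0 y0; rewrite 2!le_eqVlt => /predU1P[<-|p0] /predU1P[<-|q0].
- by rewrite addr0 !powRr0 mulr1.
- rewrite powRr0 mul1r add0r; apply: ge0_ler_powR; first exact: ltW.
  + by rewrite nnegrE divr_ge0 // ltW.
  + by rewrite nnegrE divr_ge0 ?addr_ge0 // ltW.
  + by rewrite ler_pM2r ?invr_gt0 // lerDr.
- rewrite powRr0 mulr1 addr0; apply: ge0_ler_powR; first exact: ltW.
  + by rewrite nnegrE divr_ge0 // ltW.
  + by rewrite nnegrE divr_ge0 ?addr_ge0 // ltW.
  + by rewrite ler_pM2r ?invr_gt0 // lerDl.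
move: x0 y0; rewrite 2!le_eqVlt => /predU1P[<-|x0].
  by rewrite mul0r powR0 ?mul0r ?powR_ge0 // gt_eqF.
move=> /predU1P[<-|y0].
  by rewrite mul0r (@powR0 _ q) ?mulr0 ?powR_ge0 // gt_eqF.
have pq : 0 < p + q by apply: addr_gt0.
have S0 : 0 < (x + y) / (p + q) by rewrite divr_gt0 // addr_gt0.
rewrite -ler_ln ?posrE ?mulr_gt0 ?powR_gt0 ?divr_gt0 ?addr_gt0 //.
rewrite lnM ?posrE ?powR_gt0 ?divr_gt0 // !ln_powR.
set S := (x + y) / (p + q) in S0 *.
have hx : p * (ln (x / p) - ln S) <= p * (x / p / S - 1).
  by rewrite ler_pM2l // ler_lnB // divr_gt0.
have hy : q * (ln (y / q) - ln S) <= q * (y / q / S - 1).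
  by rewrite ler_pM2l // ler_lnB // divr_gt0.
have e : p * (x / p / S - 1) + q * (y / q / S - 1) = 0.
  by rewrite /S; field; rewrite !gt_eqF // addr_gt0.
lra.
Qed.

(** Choosing [y], [z] along a curve with parameter [s] reduces the hypothesis to one variable;
    optimising [s] and applying AM-GM to [a] and [d] then gives the claim. *)
Let contraction_pos a b c d al B : 0 < a -> 0 <= b -> 0 <= c -> 0 < d ->
  b * c <= a * d -> 0 < al -> al <= 1 -> 0 <= B ->
  (forall y z, 0 < y -> 0 < z ->
     B * (y * z) `^ al <= a + y * b + z * c + y * z * d) ->
  B * (al `^ al * (1 - al) `^ (1 - al)) <= a + d.
Proof.
move=> a0 b0 c0 d0 bc al0 al1 B0 H.
move: B0; rewrite le_eqVlt => /predU1P[<-|B0]; first by rewrite mul0r ltW // addr_gt0.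
have Hs s : 0 < s -> B * (a * s ^+ 2 / d) `^ al <= a * (1 + s) ^+ 2.
  move=> s0; have [y [z [y0 z0 yb zc yz]]] : exists y z, [/\ 0 < y, 0 < z,
      y * b <= a * s, z * c <= a * s & y * z = a * s ^+ 2 / d].
    move: b0; rewrite le_eqVlt => /predU1P[b0|b0].
      exists ((c + 1) * s / d), (a * s / (c + 1)).
      have c1 : 0 < c + 1 by lra.
      have as0 : 0 < a * s by apply: mulr_gt0.
      split; rewrite -?b0 ?mulr0.
      - by rewrite divr_gt0 // mulr_gt0.
      - by rewrite divr_gt0.
      - exact: ltW.
      - by rewrite mulrAC ler_pdivrMr // ler_pM2l //; lra.
      - by field; rewrite !gt_eqF.
    exists (a * s / b), (b * s / d); split; rewrite ?divr_gt0 ?mulr_gt0 //.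
    - by rewrite divfK // gt_eqF.
    - have -> : b * s / d * c = b * c * (s / d) by ring.
      have -> : a * s = a * d * (s / d) by field; rewrite gt_eqF.
      by rewrite ler_pM2r // divr_gt0.
    - by field; rewrite !gt_eqF.
  have := H _ _ y0 z0; rewrite yz => /le_trans; apply.
  have -> : a * s ^+ 2 / d * d = a * s ^+ 2 by field; rewrite gt_eqF.
  lra.
(* For [al = 1] the optimal [s] is infinite. If [d < B], the finite value [(3 d + B) / (B - d)] is
   already large enough to violate [B s^2 <= d (1 + s)^2]. *)
have [al_eq1|al_neq1] := eqVneq al 1.
  rewrite al_eq1 subrr powRr0 powRr1 // !mulr1.
  suff : B <= d by lra.
  rewrite leNgt; apply/negP => dB.
  have h0 : 0 < (3 * d + B) / (B - d) by rewrite divr_gt0 //; lra.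
  have := Hs _ h0; rewrite al_eq1 powRr1; last first.
    exact/ltW/(divr_gt0 (mulr_gt0 a0 (exprn_gt0 _ h0)) d0).
  set s := _ / _ in h0 *.
  have -> : B * (a * s ^+ 2 / d) = a * (B * s ^+ 2 / d) by ring.
  rewrite ler_pM2l // ler_pdivrMr //; apply/negP; rewrite -ltNge.
  have sE : s * (B - d) = 3 * d + B by rewrite /s divfK // subr_eq0 gt_eqF.
  have s1 : 1 <= s by rewrite /s ler_pdivlMr; lra.
  have : s * (s * (B - d)) = s * (3 * d + B) by rewrite sE.
  have : 1 * (3 * d + B) <= s * (3 * d + B) by rewrite ler_pM2r //; lra.
  have : 0 < s * B by rewrite mulr_gt0.
  nra.
have al1' : 0 < 1 - al by rewrite subr_gt0 lt_neqAle al_neq1.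
have inv0 : 0 < (1 - al)^-1 by rewrite invr_gt0.
(* This value of [s] minimises [(1 + s)^2 / s^(2 al)]. *)
have s0 : 0 < al / (1 - al) by rewrite divr_gt0.
have := Hs _ s0.
have -> : 1 + al / (1 - al) = (1 - al)^-1 by field; rewrite gt_eqF.
have p1 : 0 < a * (al / (1 - al)) ^+ 2 / d by rewrite divr_gt0 // mulr_gt0 // exprn_gt0.
rewrite -ler_ln ?posrE ?mulr_gt0 ?powR_gt0 ?exprn_gt0 ?invr_gt0 //.
rewrite lnM ?posrE ?powR_gt0 // ln_powR ln_div ?posrE ?mulr_gt0 ?exprn_gt0 //.
rewrite ![ln (a * _)]lnM ?posrE ?exprn_gt0 ?invr_gt0 // !lnXn ?invr_gt0 //.
rewrite ln_div ?posrE // lnV ?posrE // => H1.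
have := powR_amgm (ltW a0) (ltW d0) (ltW al1') (ltW al0).
rewrite subrK divr1 powRr1; last by rewrite addr_ge0 // ltW.
move=> H2; apply: le_trans H2.
rewrite -ler_ln ?posrE ?mulr_gt0 ?powR_gt0 ?divr_gt0 //.
rewrite !lnM ?posrE ?mulr_gt0 ?powR_gt0 ?divr_gt0 // !ln_powR !ln_div ?posrE //.
lra.
Qed.

(* Bounds the value [a + d] of a bivariate multiaffine polynomial after its two
   variables are contracted; the optimal [y, z] make the four terms proportional
   to the law of two independent Bernoulli([al]) variables. *)
Lemma contraction_bound a b c d al B : 0 <= a -> 0 <= b -> 0 <= c -> 0 <= d ->
  b * c <= a * d -> 0 < al -> al <= 1 -> 0 <= B ->
  (forall y z, 0 < y -> 0 < z ->
     B * (y * z) `^ al <= a + y * b + z * c + y * z * d) ->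
  B * (al `^ al * (1 - al) `^ (1 - al)) <= a + d.
Proof.
move=> a0 b0 c0 d0 bc al0 al1 B0 H; apply/ler_addgt0Pr => e e0.
(* Raising [a] and [d] by [e / 2] makes them positive and preserves both [b c <= a d] and the lower
   bound. *)
have -> : a + d + e = (a + e / 2) + (d + e / 2) by field.
have e2 : 0 < e / 2 by rewrite divr_gt0.
apply: (contraction_pos _ b0 c0) => //; [lra|lra|nra|].
move=> y z y0 z0; apply: le_trans (H _ _ y0 z0) _.
have : 0 < y * z * (e / 2) by apply: mulr_gt0 => //; exact: mulr_gt0.
lra.
Qed.

End RealInequalities.

(** * The Bethe lower bound for monomer-dimer partition functions *)

Section BetheBound.
Variables (R : realType) (V : finType) (c : V -> bool) (al : V * V -> R).
Implicit Types (x : V -> R) (s : seq (V * V)) (v : V).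

Definition load s v : R := \sum_(e <- s | (e.1 == v) || (e.2 == v)) al e.

Lemma load_cons e s v :
  load (e :: s) v = al e *+ ((e.1 == v) || (e.2 == v)) + load s v.
Proof. by rewrite /load big_cons; case: ifP; rewrite ?mulr1n // mulr0n add0r. Qed.

(** The Bethe approximation of the partition function, where [al e] acts as the probability of using
    [e] and [1 - load s v] as that of [v] being a monomer. *)
Definition bethe x s : R :=
  \prod_(e <- s) (al e `^ (- al e) * (1 - al e) `^ (1 - al e))
  * \prod_v (x v / (1 - load s v)) `^ (1 - load s v).

(* Adding an edge [(p, q)] to [s] is the contraction of the variables [y], [z]
   by which the weights of [p] and [q] are shifted. *)
Theorem bethe_bound x s :
  (forall v, 0 <= x v) -> all (fun e => c e.1 != c e.2) s ->
  (forall e, e \in s -> 0 < al e) -> (forall v, load s v <= 1) ->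
  bethe x s <= md x s setT.
Proof.
elim: s x => [|[p q] s IH] x x0.
  move=> _ _ _; rewrite /bethe big_nil mul1r /= le_eqVlt; apply/orP; left; apply/eqP.
  under [RHS]eq_bigl do rewrite inE.
  by apply: eq_bigr => v _; rewrite /load big_nil subr0 divr1 powRr1.
move=> /= /andP[cpq cs] al_gt0 load1.
have pq : p != q by apply: contraNneq cpq => ->.
have a0 : 0 < al (p, q) by apply: al_gt0; rewrite inE eqxx.
have load0 v : 0 <= load s v.
  rewrite /load big_seq_cond; apply: sumr_ge0 => e /andP[es _].
  by rewrite ltW // al_gt0 // inE es orbT.
have a1 : al (p, q) <= 1.
  by have := load1 p; rewrite load_cons eqxx mulr1n; apply: le_trans; rewrite lerDl.
rewrite !inE pq /= mulr1n /bethe big_cons /=.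
set a := al (p, q) in a0 a1 *.
set Bs := \prod_(e <- s) _; set P := \prod_v _.
have Bs0 : 0 <= Bs by apply: prodr_ge0 => e _; rewrite mulr_ge0 ?powR_ge0.
have P0 : 0 <= P by apply: prodr_ge0 => v _; rewrite powR_ge0.
have powN0 : a `^ (- a) * a `^ a = 1.
  by rewrite -powRD ?addNr ?powRr0 ?(gt_eqF a0) ?implybT.
(* Inserting [a^(-a) a^a = 1] isolates the contraction factor; the two remaining [a^(-a)] are
   absorbed at [p] and [q]. *)
have -> : a `^ (- a) * (1 - a) `^ (1 - a) * Bs * P =
   (Bs * P * (a `^ (- a) * a `^ (- a))) * (a `^ a * (1 - a) `^ (1 - a)).
  transitivity (a `^ (- a) * (1 - a) `^ (1 - a) * Bs * P * (a `^ (- a) * a `^ a)).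
    by rewrite powN0 mulr1.
  by ring.
apply: (@contraction_bound _ _ (md x s (setT :\ p)) (md x s (setT :\ q))) => //;
  rewrite ?md_ge0 ?mulr_ge0 ?powR_ge0 //.
  have := heilmann_lieb x cs (in_setT p) (in_setT q) pq.
  by rewrite /= (negPf cpq) subr_ge0.
move=> y z y0 z0.
pose x1 v := x v + y *+ (v == p); pose x2 v := x1 v + z *+ (v == q).
have x20 v : 0 <= x2 v by rewrite !addr_ge0 ?mulrn_wge0 // ltW.
have -> : md x s setT + y * md x s (setT :\ p) + z * md x s (setT :\ q)
          + y * z * md x s (setT :\ p :\ q) = md x2 s setT.
  rewrite (md_shift x1) ?inE // !(md_shift x) ?inE ?pq //.
  have -> : [set: V] :\ p :\ q = [set: V] :\ q :\ p by rewrite !setDDl setUC.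
  ring.
have load_s v : load s v <= 1.
  by apply: le_trans (load1 v); rewrite load_cons lerDr mulrn_wge0 // ltW.
apply: le_trans (IH x2 x20 cs _ load_s); last first.
  by move=> e es; apply: al_gt0; rewrite inE es orbT.
rewrite /bethe -/Bs -!mulrA ler_wpM2l //.
have powV t : 0 < t -> (t / a) `^ a = t `^ a * a `^ (- a).
  move=> t0; rewrite powRM ?(ltW t0) ?invr_ge0 ?(ltW a0) //.
  by rewrite -powR_inv1 ?(ltW a0) // -powRrM mulN1r.
(* [g] distributes [(y z / a^2)^a] over the vertices, so that the comparison can be made vertex by
   vertex. *)
pose g v := if v == p then (y / a) `^ a else if v == q then (z / a) `^ a else 1.
have -> : P * (a `^ (- a) * (a `^ (- a) * (y * z) `^ a)) = P * \prod_v g v.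
  congr (_ * _); rewrite (bigD1 p) //= (bigD1 q) /=; last by rewrite eq_sym.
  rewrite big1; last by move=> v /andP[/negPf vp /negPf vq]; rewrite /g vp vq.
  rewrite /g eqxx eq_sym (negPf pq) eqxx !powV // powRM ?(ltW y0) ?(ltW z0) //.
  by ring.
rewrite -big_split /=; apply: ler_prod => v _.
have g0 : 0 <= g v by rewrite /g; do 2?[case: ifP => _]; rewrite ?powR_ge0.
rewrite mulr_ge0 ?powR_ge0 //=.
have : 0 <= 1 - load ((p, q) :: s) v by rewrite subr_ge0.
rewrite load_cons /= -/a (eq_sym p) (eq_sym q) => rho0.
rewrite /x2 /x1 /g; have [vp|vp] := eqVneq v p.
  move: rho0; rewrite vp eqxx (negPf pq) /= !mulr1n mulr0n addr0 => rho0.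
  (* Without the new edge, the slack at [p] is larger by [a]; AM-GM with exponents the new slack and
     [a] merges the weights [x p] and [y]. *)
  have -> : 1 - load s p = 1 - (a + load s p) + a by ring.
  by apply: powR_amgm => //; exact: ltW.
move: rho0; rewrite /= mulr0n addr0.
have [vq|vq] := eqVneq v q => /=; last by rewrite !mulr0n addr0 add0r mulr1.
rewrite vq orbT !mulr1n => rho0.
have -> : 1 - load s q = 1 - (a + load s q) + a by ring.
by apply: powR_amgm => //; exact: ltW.
Qed.

End BetheBound.

(** * Permanents: expansion along the first row *)

Section Permanents.
Local Open Scope nat_scope.

Definition perm_sum (X : finType) (K : X -> X -> nat) m (f g : 'I_m -> X) : nat :=
  \sum_(s : 'S_m) \prod_i K (f i) (g (s i)).

Lemma lift_perm_bij m :
  bijective (fun p : 'I_m.+1 * 'S_m => lift_perm ord0 p.1 p.2).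
Proof.
apply: inj_card_bij; last by rewrite card_prod !card_Sn card_ord factS.
move=> [j s] [j' s'] /= /permP e.
have jj : j = j' by have := e ord0; rewrite !lift_perm_id.
rewrite -jj in e *; congr (_, _); apply/permP => k.
by have := e (lift ord0 k); rewrite !lift_perm_lift => /lift_inj.
Qed.

Lemma perm_sum_recl (X : finType) (K : X -> X -> nat) m (f g : 'I_m.+1 -> X) :
  perm_sum K f g = \sum_j K (f ord0) (g j)
     * perm_sum K (fun i => f (lift ord0 i)) (fun i => g (lift j i)).
Proof.
rewrite /perm_sum (reindex _ (onW_bij _ (lift_perm_bij m))) /=.
rewrite -(pair_bigA _ (fun j s => \prod_i K (f i) (g (lift_perm ord0 j s i)))) /=.
apply: eq_bigr => j _; rewrite big_distrr; apply: eq_bigr => s _ /=.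
rewrite big_ord_recl lift_perm_id; congr (_ * _).
by apply: eq_bigr => i _; rewrite lift_perm_lift.
Qed.

End Permanents.

(** Deleting the elements of [Q] one by one reaches each surviving [S'] once per bijection between
    [Q] and the deleted part of [S], that is [#|Q|] factorial times. *)
Lemma sum_remove (R : nmodType) (I J : finType) (F : {set I} -> {set J} -> R) :
  (forall (S : {set I}) (Q : {set J}) q, q \in Q -> F S Q = \sum_(i in S) F (S :\ i) (Q :\ q)) ->
  forall S Q, F S Q =
    (\sum_(S' : {set I} | (S' \subset S) && (#|S'| + #|Q| == #|S|)%N) F S' set0)
      *+ #|Q|`!.
Proof.
move=> FE S Q; have [k] := ubnP #|Q|; elim: k S Q => // k IH S Q; rewrite ltnS => Qk.
have [->|[q qQ]] := set_0Vmem Q.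
  rewrite cards0 fact0 mulr1n (big_pred1 S) // => S' /=.
  by rewrite addn0 eqEcard eqn_leq; case: (boolP (_ \subset _)) => //= /subset_leq_card->.
rewrite (FE _ _ q qQ) (cardsD1 q) qQ add1n factS mulrnA.
have Qq : (#|Q :\ q| < k)%N by move: Qk; rewrite (cardsD1 q) qQ.
rewrite (eq_bigr _ (fun i _ => IH (S :\ i) _ Qq)) sumrMnl; congr (_ *+ _).
(* The first deleted element can be any of the [#|Q|] elements of [S :\: S']. *)
rewrite (exchange_big_dep (fun S' : {set I} => (S' \subset S) && (#|S'| + #|Q :\ q|.+1 == #|S|)%N)) /=.
  rewrite -sumrMnl; apply: eq_bigr => S' /andP[S'S /eqP cS].
  rewrite (eq_bigl (mem (S :\: S'))); last first.
    move=> i /=; rewrite !inE subsetD1 S'S /=; case: (boolP (i \in S)) => iS; rewrite ?andbF //=.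
    by move: cS; rewrite (cardsD1 i S) iS addnS add1n => /succn_inj->; rewrite eqxx.
  by rewrite sumr_const cardsD (setIidPr S'S) -cS addKn.
move=> i S' iS /andP[]; rewrite subsetD1 => /andP[-> _] /eqP e.
by rewrite (cardsD1 i S) iS addnS e add1n eqxx.
Qed.

(** * Perfect matchings of bipartite multigraphs as permanents *)

Section PerfectMatchings.
Variables (R : realType) (X : finType) (K : X -> X -> nat).
Implicit Types (S T : {set X}).

Definition edges : seq ((bool * X) * (bool * X)) :=
  flatten [seq nseq (K e.1 e.2) ((true, e.1), (false, e.2)) | e <- index_enum (X * X)%type].

Lemma big_edges (T : Type) (idx : T) (op : Monoid.com_law idx) F :
  \big[op/idx]_(e <- edges) F e =
  \big[op/idx]_a \big[op/idx]_b iter (K a b) (op (F ((true, a), (false, b)))) idx.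
Proof.
rewrite /edges big_flatten big_map pair_bigA /=.
by apply: eq_bigr => e _; rewrite big_nseq.
Qed.

Lemma edges_bip : all (fun e => e.1.1 != e.2.1) edges.
Proof. by apply/allP => e /flatten_mapP[a _]; rewrite mem_nseq => /andP[_ /eqP->]. Qed.

Lemma mult_edges a b : mult edges (true, a) (false, b) = K a b.
Proof.
rewrite /mult [X in (_ + X)%N](_ : _ = 0%N) ?addn0; last first.
  by apply/count_memPn/negP => /flatten_mapP[e _]; rewrite mem_nseq => /andP[_ /eqP].
rewrite -sum1_count big_mkcond big_edges /=.
rewrite (bigD1 a) //= (bigD1 b) //= eqxx big1 ?big1 ?addn0.
- by elim: (K a b) => //= k ->.
- move=> a' a'a; apply: big1 => b' _; rewrite !xpair_eqE (negPf a'a) /=.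
  by elim: (K _ _).
- move=> b' b'b; rewrite !xpair_eqE (negPf b'b) !andbF /=.
  by elim: (K _ _).
Qed.

Definition side S T : {set bool * X} := [set v | if v.1 then v.2 \in S else v.2 \in T].

(** Monomers have weight 0, so only perfect matchings between [S] and [T] contribute. *)
Definition pmatch S T : R := md (fun=> 0) edges (side S T).

Lemma sideD1l S T a : side S T :\ (true, a) = side (S :\ a) T.
Proof. by apply/setP=> -[[] b]; rewrite !inE xpair_eqE. Qed.

Lemma sideD1r S T b : side S T :\ (false, b) = side S (T :\ b).
Proof. by apply/setP=> -[[] a]; rewrite !inE xpair_eqE. Qed.

Lemma sum_side S T (F : bool * X -> R) :
  \sum_(v in side S T) F v = \sum_(a in S) F (true, a) + \sum_(b in T) F (false, b).
Proof.
rewrite big_mkcond.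
transitivity (\sum_c \sum_a if (c, a) \in side S T then F (c, a) else 0).
  by rewrite pair_bigA; apply: eq_bigr => -[].
by rewrite big_bool /=; congr (_ + _); rewrite [RHS]big_mkcond; apply: eq_bigr => a _; rewrite inE.
Qed.

Lemma pmatch_row S T a : a \in S -> pmatch S T = \sum_(b in T) pmatch (S :\ a) (T :\ b) *+ K a b.
Proof.
move=> aS; rewrite {1}/pmatch (@md_expand _ _ _ _ _ (true, a)) ?inE // mul0r add0r.
rewrite sideD1l sum_side big1 ?add0r; last first.
  by move=> i _; rewrite (mult_monochromatic edges_bip) ?mulr0n.
by apply: eq_bigr => b _; rewrite mult_edges sideD1r.
Qed.

Lemma pmatch_col S T b : b \in T -> pmatch S T = \sum_(a in S) pmatch (S :\ a) (T :\ b) *+ K a b.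
Proof.
move=> bT; rewrite {1}/pmatch (@md_expand _ _ _ _ _ (false, b)) ?inE // mul0r add0r.
rewrite sideD1r sum_side [X in _ + X]big1 ?addr0; last first.
  by move=> i _; rewrite (mult_monochromatic edges_bip) ?mulr0n.
by apply: eq_bigr => a _; rewrite mult_sym mult_edges sideD1l.
Qed.

Lemma pmatch0 : pmatch set0 set0 = 1.
Proof.
rewrite /pmatch; have -> : side set0 set0 = set0 by apply/setP=> -[[] a]; rewrite !inE.
by elim: edges => [|e s IH] /=; rewrite ?big_set0 // inE mulr0n addr0.
Qed.

(** Both sides satisfy the same expansion along the first row. *)
Lemma pmatch_perm_sum m (f g : 'I_m -> X) : injective f -> injective g ->
  pmatch (f @: setT) (g @: setT) = (perm_sum K f g)%:R.
Proof.
elim: m f g => [|m IH] f g fI gI.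
  have im0 (h : 'I_0 -> X) : h @: setT = set0.
    by apply/setP=> y; rewrite inE; apply/imsetP=> -[[]].
  rewrite !im0 pmatch0 /perm_sum (eq_bigr (fun=> 1%N)) ?sum1_card ?card_Sn // => s _.
  by rewrite big_ord0.
rewrite perm_sum_recl (@pmatch_row _ _ (f ord0)) ?imset_f ?inE // big_imset /=; last first.
  by move=> i j _ _ /gI.
have imD1 (h : 'I_m.+1 -> X) j : injective h ->
    h @: setT :\ h j = (fun i => h (lift j i)) @: setT.
  move=> hI; apply/setP=> y; rewrite !inE; apply/andP/imsetP => [[yj /imsetP[i _ yi]]|[i _ ->]].
    case: (unliftP j i) yi yj => [i' -> ->|-> ->]; last by rewrite eqxx.
    by exists i'.
  by rewrite (inj_eq hI) lift_eqF imset_f ?inE.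
rewrite natr_sum; apply: eq_big => [j|j _]; first by rewrite inE.
rewrite !imD1 // IH; first by rewrite natrM mulr_natl.
- by move=> i i' /fI /lift_inj.
- by move=> i i' /gI /lift_inj.
Qed.

End PerfectMatchings.

Lemma sum_sub (R : nmodType) (I : finType) (P : pred I) (F : I -> R) :
  \sum_(i : {i | P i}) F (val i) = \sum_(i | P i) F i.
Proof.
rewrite [RHS](reindex_omap (J := {i | P i}) val insub) => [|i Pi]; last by rewrite insubT.
by apply: eq_bigl => i; rewrite (valP i) valK eqxx.
Qed.

(** * The augmented graph and sums of subpermanents *)

Section Augmentation.
Variables (R : realType) (n k : nat) (A : 'M[nat]_n).
Implicit Types (S T : {set 'I_n}) (P Q : {set 'I_k}).

(* A perfect matching of the augmented graph is an [(n - k)]-matching of [A]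
   together with pairings of the uncovered rows and columns with the [k] new
   columns and rows. *)
Definition augment (a b : 'I_n + 'I_k) : nat :=
  match a, b with
  | inl i, inl j => A i j
  | inr _, inr _ => 0
  | _, _ => 1
  end.

Definition glue S P : {set 'I_n + 'I_k} :=
  [set a | match a with inl i => i \in S | inr p => p \in P end].

Let N S P T Q : R := pmatch R augment (glue S P) (glue T Q).

Lemma glueD1l S P i : glue S P :\ inl i = glue (S :\ i) P.
Proof. by apply/setP=> -[j|p]; rewrite !inE. Qed.

Lemma glueD1r S P q : glue S P :\ inr q = glue S (P :\ q).
Proof. by apply/setP=> -[j|p]; rewrite !inE. Qed.

Lemma sum_glue S P (F : 'I_n + 'I_k -> R) :
  \sum_(a in glue S P) F a = \sum_(i in S) F (inl i) + \sum_(p in P) F (inr p).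
Proof. by rewrite big_sumType /=; congr (_ + _); apply: eq_bigl => i; rewrite inE. Qed.

Lemma remove_col S P T Q q : q \in Q ->
  N S P T Q = \sum_(i in S) N (S :\ i) P T (Q :\ q).
Proof.
move=> qQ; rewrite /N (@pmatch_col _ _ _ _ _ (inr q)) ?inE // sum_glue.
rewrite [X in _ + X]big1 ?addr0 => [|p _]; last by rewrite mulr0n.
by apply: eq_bigr => i _; rewrite mulr1n glueD1l glueD1r.
Qed.

Lemma remove_row S P T Q p : p \in P ->
  N S P T Q = \sum_(j in T) N S (P :\ p) (T :\ j) Q.
Proof.
move=> pP; rewrite /N (@pmatch_row _ _ _ _ _ (inr p)) ?inE // sum_glue.
rewrite [X in _ + X]big1 ?addr0 => [|q _]; last by rewrite mulr0n.
by apply: eq_bigr => i _; rewrite mulr1n glueD1l glueD1r.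
Qed.

Lemma pmatch_subST m (S T : {S : {set 'I_n} | #|S| == m}) :
  N (val S) set0 (val T) set0 = (per (subST A S T))%:R.
Proof.
pose enum (S : {S : {set 'I_n} | #|S| == m}) i : 'I_n + 'I_k :=
  inl (enum_val (cast_ord (esym (eqP (valP S))) i)).
have enumI U : injective (enum U) by move=> i j [] /enum_val_inj /cast_ord_inj.
have im U : enum U @: setT = glue (val U) set0.
  apply/setP=> -[i|p]; rewrite !inE; last by apply/imsetP=> -[].
  apply/imsetP/idP => [[j _ [->]]|iU]; first exact: enum_valP.
  exists (cast_ord (eqP (valP U)) (enum_rank_in iU i)) => //.
  by rewrite /enum cast_ordK enum_rankK_in.
rewrite /N -!im pmatch_perm_sum //; congr (_%:R).
by apply: eq_bigr => s _; apply: eq_bigr => i _; rewrite mxE.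
Qed.

Lemma pmatch_augment m : (m + k)%N = n ->
  pmatch R augment setT setT = (per_m A m)%:R * (k`!)%:R ^+ 2.
Proof.
move=> mk; have glueT : glue setT setT = setT by apply/setP=> -[i|p]; rewrite !inE.
rewrite -glueT -/(N _ _ _ _).
(* Deleting the [k] new columns leaves [m] old rows and a factor [k!]; the new rows then do the same
   for the old columns. *)
rewrite (sum_remove (F := fun S Q => N S setT setT Q)); last by move=> *; exact: remove_col.
have cm (S : {set 'I_n}) : (S \subset setT) && (#|S| + #|[set: 'I_k]| == #|[set: 'I_n]|)%N
    = (#|S| == m).
  by rewrite subsetT !cardsT !card_ord -[X in _ == X]mk eqn_add2r.
rewrite (eq_bigl _ _ cm).
rewrite (eq_bigr (fun S => (\sum_(T : {set 'I_n} | #|T| == m) N S set0 T set0) *+ k`!)); last first.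
  move=> S _; rewrite (sum_remove (F := fun T P => N S P T set0)); last by move=> *; exact: remove_row.
  by rewrite (eq_bigl _ _ cm) cardsT card_ord.
rewrite cardsT card_ord sumrMnl -mulrnA -[LHS]mulr_natr natrM expr2; congr (_ * _).
rewrite -sum_sub /per_m natr_sum; apply: eq_bigr => S _.
rewrite -sum_sub natr_sum; apply: eq_bigr => T _; exact: pmatch_subST.
Qed.

End Augmentation.

(** * The Bethe bound for doubly stochastic edge weights *)

Section BetheAugmented.
Variables (R : realType) (X : finType) (K : X -> X -> nat) (w : X -> X -> R).

Let al (e : (bool * X) * (bool * X)) : R := w e.1.2 e.2.2.

Lemma load_row a : load al (edges K) (true, a) = \sum_b w a b *+ K a b.
Proof.
rewrite /load big_mkcond big_edges (bigD1 a) //= [X in _ + X]big1 ?addr0.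
  by apply: eq_bigr => b _; rewrite xpair_eqE !eqxx iter_addr_0.
move=> a' a'a; apply: big1 => b _.
by rewrite !xpair_eqE (negPf a'a) iter_addr_0 mul0rn.
Qed.

Lemma load_col b : load al (edges K) (false, b) = \sum_a w a b *+ K a b.
Proof.
rewrite /load big_mkcond big_edges; apply: eq_bigr => a _ /=.
rewrite (bigD1 b) //= xpair_eqE !eqxx iter_addr_0 big1 ?addr0 // => b' b'b.
by rewrite !xpair_eqE (negPf b'b) iter_addr_0 mul0rn.
Qed.

Lemma pmatch_bethe_bound : (forall a b, 0 < w a b) ->
  (forall a, \sum_b w a b *+ K a b = 1) -> (forall b, \sum_a w a b *+ K a b = 1) ->
  \prod_a \prod_b (w a b `^ (- w a b) * (1 - w a b) `^ (1 - w a b)) ^+ K a b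
    <= pmatch R K setT setT.
Proof.
move=> w0 row1 col1.
have load1 v : load al (edges K) v = 1.
  by case: v => [[] a]; rewrite ?load_row ?load_col.
have := @bethe_bound R _ (fun v => v.1) al (fun=> 0) (edges K) (fun=> lexx 0)
  (edges_bip K) (fun e _ => w0 _ _) _.
rewrite /pmatch; have -> : side setT setT = setT :> {set bool * X}.
  by apply/setP=> -[[] a]; rewrite !inE.
move=> /(_ _)/le_trans => H; apply: le_trans (H _ _ (lexx _)); last by move=> v; rewrite load1.
(* All loads are 1, so every vertex factor has exponent 0 and equals 1, despite its base [0 / 0]. *)
rewrite /bethe big_edges [X in _ * X]big1 ?mulr1; last first.
  by move=> v _; rewrite load1 subrr powRr0.
by under [leRHS]eq_bigr do under eq_bigr do rewrite iter_mulr_1.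
Qed.

End BetheAugmented.

(** * The closed form and the final bound *)

(** Regroups [SF] by edges: [n r] edges of [A] with weight [al] and [2 n (n - m)] new edges with
    weight [1 / n]. *)
Lemma SF_eq (R : realType) (r n m : nat) : (0 < r)%N -> (0 < n)%N -> (m <= n)%N ->
  let al : R := m%:R / n%:R / r%:R in let be : R := n%:R^-1 in
  SF R r n m = (al `^ (- al) * (1 - al) `^ (1 - al)) ^+ (n * r)
    * (be `^ (- be) * (1 - be) `^ (1 - be)) ^+ (2 * n * (n - m)) / (n - m)`!%:R ^+ 2.
Proof.
move=> r0 n0 mn /=; rewrite /SF; set t : R := _ / n%:R; set al := t / r%:R.
have rR : r%:R != 0 :> R by rewrite pnatr_eq0 -lt0n.
have nR : n%:R != 0 :> R by rewrite pnatr_eq0 -lt0n.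
have n1t : (n - m)%:R = n%:R * (1 - t) :> R by rewrite natrB // /t; field.
rewrite !exprMn.
rewrite -!(powR_mulrn _ (powR_ge0 _ _)) -!powRrM.
have -> : - al * (n * r)%:R = - (n%:R * t) by rewrite natrM /al; field.
have -> : (1 - al) * (n * r)%:R = (1 - al) * n%:R * r%:R by rewrite natrM; ring.
have -> : (1 - n%:R^-1) * (2 * n * (n - m))%:R
    = (1 - n%:R^-1) * 2 * n%:R ^+ 2 * (1 - t) :> R by rewrite !natrM n1t; ring.
have -> : - n%:R^-1 * (2 * n * (n - m))%:R = - (2 * n%:R * (1 - t)) :> R.
  by rewrite !natrM n1t; field.
have -> : n%:R^-1 `^ (- (2 * n%:R * (1 - t))) = (n%:R `^ (- (2 * n%:R * (1 - t))))^-1 :> R.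
  by rewrite -[X in X `^ _]powR_inv1 // -powRrM mulN1r powRN.
rewrite powRN !invfM; ring.
Qed.

Theorem theorem6p2 (R : realType) (r n : nat) (A : 'M[nat]_n) (m : nat) :
  (0 < r)%N -> (0 < n)%N -> RI r n A -> (0 < m)%N -> (m <= n)%N ->
  SF R r n m <= (per_m A m)%:R.
Proof.
move=> r0 n0 [rowA colA] m0 mn; rewrite SF_eq //.
set k := (n - m)%N; set al : R := _ / r%:R; set be : R := n%:R^-1.
have rR : 0 < r%:R :> R by rewrite ltr0n.
have nR : 0 < n%:R :> R by rewrite ltr0n.
have al0 : 0 < al by rewrite !divr_gt0 ?ltr0n.
have be0 : 0 < be by rewrite invr_gt0.
rewrite ler_pdivrMr ?exprn_gt0 ?ltr0n ?fact_gt0 //.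
rewrite -(@pmatch_augment R n k A m) ?subnKC //.
pose w (a b : 'I_n + 'I_k) : R := if (a, b) is (inl _, inl _) then al else be.
(* An old vertex has [r] old and [k] new edges, giving [m / n + (n - m) / n]; a new vertex has [n]
   edges of weight [1 / n]. *)
have alr : al *+ r + be *+ k = 1.
  rewrite -[al *+ _]mulr_natr -[be *+ _]mulr_natr natrB // /al /be.
  by field; rewrite !gt_eqF.
have ben : be *+ n = 1 by rewrite -mulr_natr mulVf // gt_eqF.
apply: le_trans (pmatch_bethe_bound (w := w) _ _ _).
- rewrite /w big_sumType /= le_eqVlt; apply/orP; left; apply/eqP.
  under [X in _ = X * _]eq_bigr => i _.
    rewrite big_sumType /= -expr_sum rowA.
    under [X in _ * X]eq_bigr do rewrite expr1.
    rewrite prodr_const card_ord; over.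
  under [X in _ = _ * X]eq_bigr => i _.
    rewrite big_sumType /= [X in _ * X]big1 ?mulr1 => [|q _]; last by rewrite expr0.
    under eq_bigr do rewrite expr1.
    rewrite prodr_const card_ord; over.
  move: (al `^ _ * _) (be `^ _ * _) => Fa Fb /=.
  rewrite !prodr_const !card_ord exprMn -!exprM -mulrA -exprD.
  by congr (_ ^+ _ * _ ^+ _); lia.
- by rewrite /w => -[i|p] [j|q].
- rewrite /w => -[i|p]; rewrite big_sumType /=.
    by rewrite sumrMnr rowA sumr_const card_ord mulr1n.
  by rewrite [X in _ + X]big1 // addr0 mulr1n sumr_const card_ord.
- rewrite /w => -[i|p]; rewrite big_sumType /=.
    by rewrite sumrMnr colA sumr_const card_ord mulr1n.
  by rewrite [X in _ + X]big1 // addr0 mulr1n sumr_const card_ord.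
Qed.
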